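(* Let $X_1,X_2$ be disjoint well-ordered sets, let $\mathcal{A}_i=\mathcal{L}_{(2)}(X_i|S_i)$, where $S_i\subset\mathcal{L}_{(2)}(X_i)^{(1)}$ is a set of monic polynomials, and let $S_i^C$ be a Gröbner–Shirshov complement of $S_i$ in $\mathcal{L}_{(2)}(X_i)$, $i=1,2$. Let $X_1\cup X_2$ be well-ordered by an order extending those of $X_1$ and $X_2$. Then $S_1^C\cup S_2^C$ is a Gröbner–Shirshov basis (in $\mathcal{L}_{(2)}(X_1\cup X_2)$) for the free metabelian Lie product $\mathcal{A}_1*\mathcal{A}_2=\mathcal{L}_{(2)}(X_1\cup X_2|S_1\cup S_2)$.
   Context: $\mathbf{k}$ is a field of arbitrary characteristic. For a well-ordered set $X$, $\mathcal{L}_{(2)}(X)=Lie(X)/Lie(X)^{(2)}$ is the free metabelian Lie algebra over $\mathbf{k}$ on $X$, where $\mathcal{L}^{(0)}=\mathcal{L}$, $\mathcal{L}^{(n+1)}=[\mathcal{L}^{(n)},\mathcal{L}^{(n)}]$; $\mathcal{L}_{(2)}(X|S)=\mathcal{L}_{(2)}(X)/Id(S)$, where $Id(S)$ is the ideal generated by $S$. The Lie product is written $uv$ or $u\cdot v$; products without brackets are left-normed. ''A Gröbner–Shirshov basis for $\mathcal{L}_{(2)}(X|S)$'' is a Gröbner–Shirshov basis in $\mathcal{L}_{(2)}(X)$ generating the ideal $Id(S)$. Words. $[X]$ is the free commutative monoid on $X$; $\langle a_{1}\cdots a_{m}\rangle$ denotes the letters rearranged in non-decreasing order. $R=\{a_0a_1\cdots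 a_n \mid n\ge1,\ a_i\in X,\ a_0>a_1\le a_2\le\cdots\le a_n\}$ and $N=X\cup R$ (regular words), a $\mathbf{k}$-basis of $\mathcal{L}_{(2)}(X)$; thus $\mathcal{L}_{(2)}(X)^{(1)}=\mathbf{k}R$. Each $f$ is uniquely $f=f^{(1)}+f^{(0)}$, $f^{(1)}\in\mathbf{k}R$, $f^{(0)}\in\mathbf{k}X$. Length: $|a|=1$ for $a\in X$, $|a_0a_1\cdots a_n|=n+1$. $N$ is ordered degree-lexicographically (first by length, then lexicographically). For $f\ne0$, $\bar f$ is the largest word occurring in $f$ with nonzero coefficient (leading word); $f$ is monic if the coefficient of $\bar f$ is $1$. Conditions mentioning $\bar h$ presuppose $h\ne0$. Normal $S$-words: (i) $sa_1a_2\cdots a_n$ with $s\in S$, $n\ge0$, $a_i\in X$, $a_1\le\cdots\le a_n$, $\bar s\ne a_1$ (no condition on letters if $n=0$); (ii) $us$ with $u\in R$, $s\in S$, $\bar s\neq u$. Compositions. Let $f,g$ be monic, $\alpha,\beta$ the coefficients of $\overline{f^{(0)}}$, $\overline{g^{(0)}}$ in $f$, $g$. $f\langle c_1\cdots c_r\rangle$ is the left-normed product of $f$ by the letters in non-decreasing order; a hat means omission. Type I: $\bar f=a_0a_1\cdots a_n$, $\bar g=a_0b_1\cdots b_m$ ($n,m\ge0$), $L$ the least common multiple in $[X]$ of $a_1\cdots a_n$ and $b_1\cdots b_m$, $w=a_0\langle L\rangle$: $C_I(f,g)_w=f\langle L/(a_1\cdots a_n)\rangle-g\langle L/(b_1\cdots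 b_m)\rangle$. Type II: $\bar f=\overline{f^{(1)}}=a_0a_1\cdots a_n$, and $\overline{g^{(0)}}=a_i$ for some $i\ge2$, or $\overline{g^{(0)}}=a_1$ (put $i=1$) and $a_0>a_2$; $w=\bar f$: $C_{II}(f,g)_w=f-\beta^{-1}a_0a_1\cdots\hat{a_i}\cdots a_n\cdot g$. Type III: $\bar f=\overline{f^{(1)}}=a_0a_1\cdots a_n$, $\bar g=\overline{g^{(0)}}=a_1$, and $a_0\le a_2$ or $n=1$; $w=\bar f$: $C_{III}(f,g)_w=f+ga_0a_2\cdots a_n$. Type IV: $\bar f=\overline{f^{(1)}}=a_0a_1\cdots a_n$, $g^{(1)}\ne0$, $\overline{g^{(0)}}=a_1$, and $a_0\le a_2$ or $n=1$; for any $a\in X$ with $a<a_0$, $w=a_0\langle a_1\cdots a_na\rangle$: $C_{IV}(f,g)_w=fa-\beta^{-1}a_0aa_2\cdots a_n\cdot g$. Type V: $\bar f=\overline{f^{(1)}}=a_0a_1\cdots a_n$, $f^{(0)}\ne0$, $g^{(1)}\ne0$, $\overline{g^{(0)}}=b\notin\{a_i\}_{i=1}^n$; $w=a_0\langle a_1\cdots a_nb\rangle$: $C_V(f,g)_w=fb-\beta^{-1}a_0a_1\cdots a_n\cdot g$. Type VI: $\overline{f^{(0)}}=\overline{g^{(0)}}=a$, $f^{(1)}\ne0$; for any $a_0a_1\in R$, $w=a_0\langle a_1a\rangle$: $C_{VI}(f,g)_w=(a_0a_1)(\alpha^{-1}f-\beta^{-1}g)$. Type VII: $f^{(1)}\ne0$,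 $g^{(1)}\ne0$, $\overline{f^{(0)}}=a>\overline{g^{(0)}}=b$; for any $a_0\in X$, $a_0>a$, $w=a_0ba$: $C_{VII}(f,g)_w=\alpha^{-1}(a_0b)f-\beta^{-1}(a_0a)g$. Triviality: for a set $S$ of monic polynomials and $w\in N$, $f\equiv0\ mod(S,w)$ means that $f$ is a $\mathbf{k}$-linear combination of normal $S$-words $u_s$ with $\overline{u_s}<w$. $S$ is a Gröbner–Shirshov basis if $C_\lambda(f,g)_w\equiv0\ mod(S,w)$ for all $f,g\in S$ and all compositions. A Gröbner–Shirshov complement $S^C$ of $S$ is a Gröbner–Shirshov basis generating the same ideal as $S$, obtained from $S$ by repeatedly adding nontrivial compositions (normalized to be monic), i.e. by Shirshov's algorithm. *)

(* Defs.v *)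
From HB Require Import structures.
From mathcomp Require Import all_boot all_order all_algebra.
From mathcomp Require Import generic_quotient ring_quotient.
From mathcomp Require Import finmap multiset.
From mathcomp Require Import boolp classical_sets.

Set Implicit Arguments.
Unset Strict Implicit.
Unset Printing Implicit Defensive.

Import Order.TTheory GRing.Theory.
Local Open Scope classical_set_scope.
Local Open Scope ring_scope.
Local Open Scope quotient_scope.

(** * Lie algebras over a field of arbitrary characteristic *)

HB.mixin Record Lmodule_isLie (k : fieldType) L of GRing.Lmodule k L := {
  lieb : L -> L -> L;
  liebDl : forall u v w : L, lieb (u + v) w = lieb u w + lieb v w;
  liebDr : forall u v w : L, lieb u (v + w) = lieb u v + lieb u w;
  liebZl : forall (c : k) (u v : L), lieb (c *: u) v = c *: lieb u v;
  liebZr : forall (c : k) (u v : L), lieb u (c *: v) = c *: lieb u v;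
  liebb : forall u : L, lieb u u = 0;
  lieb_jacobi : forall u v w : L,
    lieb (lieb u v) w + lieb (lieb v w) u + lieb (lieb w u) v = 0
}.

#[short(type="lieAlgType")]
HB.structure Definition LieAlgebra (k : fieldType) :=
  { L of Lmodule_isLie k L & GRing.Lmodule k L }.

Notation "u *L v" := (lieb u v) (at level 40, left associativity).

Section LieTheory.
Variables (k : fieldType) (L : lieAlgType k).
Implicit Types (A I : set L) (u v w : L).

Lemma lieb0l v : 0 *L v = 0.
Proof. by rewrite -{1}(scale0r (0 : L)) liebZl scale0r. Qed.

Lemma lieb0r u : u *L 0 = 0.
Proof. by rewrite -{1}(scale0r (0 : L)) liebZr scale0r. Qed.

Lemma liebNl u v : (- u) *L v = - (u *L v).
Proof. by rewrite -!scaleN1r liebZl. Qed.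

Lemma liebNr u v : u *L (- v) = - (u *L v).
Proof. by rewrite -!scaleN1r liebZr. Qed.

Lemma liebC u v : u *L v = - (v *L u).
Proof.
apply/eqP; rewrite -addr_eq0; apply/eqP.
by rewrite -(liebb (u + v)) !liebDl !liebDr !liebb addr0 add0r.
Qed.

Lemma lieb_suml n (F : 'I_n -> L) v :
  (\sum_(i < n) F i) *L v = \sum_(i < n) F i *L v.
Proof.
by apply: (big_morph (fun u => u *L v)) => [u w|]; rewrite ?lieb0l ?liebDl.
Qed.

Definition lspan A : set L :=
  [set u | exists n (c : 'I_n -> k) (v : 'I_n -> L),
     (forall i, A (v i)) /\ u = \sum_(i < n) c i *: v i].

Lemma lspan_sub A : A `<=` lspan A.
Proof.
move=> u Au; exists 1%N, (fun=> 1), (fun=> u).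
by rewrite big_ord1 scale1r.
Qed.

Lemma lspan0 A : lspan A 0.
Proof. by exists 0%N, (fun=> 0), (fun=> 0); rewrite big_ord0; split=> [[]|]. Qed.

Lemma lspanD A u v : lspan A u -> lspan A v -> lspan A (u + v).
Proof.
move=> [n [c [x [Ax ->]]]] [m [e [y [Ay ->]]]].
exists (n + m)%N.
exists (fun i => match split i with inl j => c j | inr j => e j end).
exists (fun i => match split i with inl j => x j | inr j => y j end); split.
  by move=> i; case: (split i).
rewrite big_split_ord /=; congr (_ + _); apply: eq_bigr => i _.
  by rewrite (unsplitK (inl i)).
by rewrite (unsplitK (inr i)).
Qed.

Lemma lspanZ A a u : lspan A u -> lspan A (a *: u).
Proof.
move=> [n [c [x [Ax ->]]]]; exists n, (fun i => a * c i), x; split=> //.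
by rewrite scaler_sumr; apply: eq_bigr => i _; rewrite scalerA.
Qed.

Lemma lspan_sum A n (F : 'I_n -> L) :
  (forall i, lspan A (F i)) -> lspan A (\sum_(i < n) F i).
Proof.
by move=> AF; apply: big_ind => // [|u v]; [exact: lspan0|exact: lspanD].
Qed.

(* Two-sided and one-sided ideals coincide, by anticommutativity. *)
Record is_ideal I : Prop := IsIdeal {
  ideal0 : I 0;
  idealD : forall u v, I u -> I v -> I (u + v);
  idealZ : forall c u, I u -> I (c *: u);
  idealM : forall u v, I u -> I (u *L v)
}.

Lemma smallest_ideal A : is_ideal (smallest is_ideal A).
Proof.
split=> [I [iI _]|u v Au Av I iIA|c u Au I iIA|u v Au I iIA].
- exact: ideal0 iI.
- by apply: (idealD iIA.1); [exact: Au|exact: Av].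
- by apply: (idealZ iIA.1); exact: Au.
- by apply: (idealM iIA.1); exact: Au.
Qed.

Fixpoint derived (n : nat) : set L :=
  if n is m.+1 then lspan [set u *L v | u in derived m & v in derived m]
  else setT.

Lemma derived_ideal n : is_ideal (derived n).
Proof.
elim: n => [|n IHn]; first by split.
split; [exact: lspan0|exact: lspanD|exact: lspanZ|].
move=> _ z [m [c [x [Ax ->]]]]; rewrite lieb_suml; apply: lspan_sum => i.
rewrite liebZl; apply: lspanZ; have [u Du [v Dv <-]] := Ax i.
have -> : (u *L v) *L z = (u *L z) *L v - (v *L z) *L u.
  have /eqP := lieb_jacobi u v z; rewrite -addrA addr_eq0 => /eqP ->.
  by rewrite opprD addrC; congr (_ - _); rewrite (liebC z u) liebNl opprK.
by rewrite -liebNl; apply: lspanD; apply: lspan_sub;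
  [exists (u *L z); [exact: idealM|exists v]
  |exists (- (v *L z)); [rewrite -scaleN1r; apply: idealZ => //;
   exact: idealM|exists u]].
Qed.

End LieTheory.

Arguments derived {k} L n.

Definition is_lie_hom (k : fieldType) (L M : lieAlgType k) (h : L -> M) :=
  [/\ forall u v, h (u + v) = h u + h v,
      forall c u, h (c *: u) = c *: h u &
      forall u v, h (u *L v) = h u *L h v].

(** * Quotient of a Lie algebra by an ideal *)

Section LieQuotient.
Variables (k : fieldType) (L : lieAlgType k) (I : set L) (idI : is_ideal I).

Definition ideal_mem of is_ideal I : {pred L} := fun u => `[< I u >].

Lemma ideal_mem_zmod : zmod_closed (ideal_mem idI).
Proof.
split=> [|u v]; first exact/asboolP/(ideal0 idI).
move=> /asboolP Iu /asboolP Iv; apply/asboolP; apply: (idealD idI) => //.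
by rewrite -scaleN1r; exact: (idealZ idI).
Qed.

HB.instance Definition _ :=
  GRing.isZmodClosed.Build L (ideal_mem idI) ideal_mem_zmod.

Definition liequot := Quotient.quot (ideal_mem idI).

HB.instance Definition _ := GRing.Zmodule.on liequot.

Definition lpi (u : L) : liequot := \pi_(Quotient.quot (ideal_mem idI)) u.

Lemma lpi_eq u v : lpi u = lpi v <-> I (u - v).
Proof.
rewrite /lpi; split.
  by move=> /eqP; rewrite -Quotient.idealrBE => /asboolP.
by move=> /asboolP Iuv; apply/eqP; rewrite -Quotient.idealrBE.
Qed.

Lemma lpi_repr (x : liequot) : lpi (repr x) = x.
Proof. exact: reprK. Qed.

Lemma lpiD u v : lpi (u + v) = lpi u + lpi v.
Proof. by rewrite /lpi [LHS]Quotient.pi_add. Qed.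

Definition liequot_scale (c : k) (x : liequot) : liequot := lpi (c *: repr x).
Definition liequot_bracket (x y : liequot) : liequot := lpi (repr x *L repr y).

Let repr_lpi u : I (repr (lpi u) - u).
Proof. by apply/lpi_eq; rewrite lpi_repr. Qed.

Let scaleE c u : liequot_scale c (lpi u) = lpi (c *: u).
Proof. by apply/lpi_eq; rewrite -scalerBr; apply: (idealZ idI); apply: repr_lpi. Qed.

Let brE u v : liequot_bracket (lpi u) (lpi v) = lpi (u *L v).
Proof.
apply/lpi_eq; set u' := repr _; set v' := repr _.
have -> : u' *L v' - u *L v = (u' - u) *L v' - (v' - v) *L u.
  rewrite !liebDl !liebNl (liebC v' u) (liebC v u) opprD !opprK.
  by rewrite addrA addrNK.
apply: (idealD idI); first by apply: (idealM idI); apply: repr_lpi.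
rewrite -liebNl; apply: (idealM idI); rewrite -scaleN1r; apply: (idealZ idI).
exact: repr_lpi.
Qed.

Let lpiP (P : liequot -> Prop) : (forall u, P (lpi u)) -> forall x, P x.
Proof. by move=> h x; rewrite -[x]lpi_repr. Qed.

Let scaleA a b x :
  liequot_scale a (liequot_scale b x) = liequot_scale (a * b) x.
Proof. by elim/lpiP: x => u; rewrite !scaleE scalerA. Qed.

Let scale1 : left_id 1 liequot_scale.
Proof. by elim/lpiP=> u; rewrite scaleE scale1r. Qed.

Let scaleDr : right_distributive liequot_scale +%R.
Proof.
by move=> c; elim/lpiP=> u; elim/lpiP=> v; rewrite -lpiD !scaleE -lpiD scalerDr.
Qed.

Let scaleDl x : {morph liequot_scale^~ x : a b / a + b}.
Proof. by move=> a b; elim/lpiP: x => u; rewrite !scaleE -lpiD scalerDl. Qed.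

HB.instance Definition _ := GRing.Zmodule_isLmodule.Build k liequot
  scaleA scale1 scaleDr scaleDl.

Lemma lpiZ c u : lpi (c *: u) = c *: lpi u.
Proof. by rewrite -scaleE. Qed.

Let brDl (x y z : liequot) :
  liequot_bracket (x + y) z = liequot_bracket x z + liequot_bracket y z.
Proof.
by elim/lpiP: x => u; elim/lpiP: y => v; elim/lpiP: z => w;
  rewrite -lpiD !brE -lpiD liebDl.
Qed.

Let brDr (x y z : liequot) :
  liequot_bracket x (y + z) = liequot_bracket x y + liequot_bracket x z.
Proof.
by elim/lpiP: x => u; elim/lpiP: y => v; elim/lpiP: z => w;
  rewrite -lpiD !brE -lpiD liebDr.
Qed.

Let brZl c (x y : liequot) :
  liequot_bracket (c *: x) y = c *: liequot_bracket x y.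
Proof.
by elim/lpiP: x => u; elim/lpiP: y => v; rewrite -lpiZ !brE -lpiZ liebZl.
Qed.

Let brZr c (x y : liequot) :
  liequot_bracket x (c *: y) = c *: liequot_bracket x y.
Proof.
by elim/lpiP: x => u; elim/lpiP: y => v; rewrite -lpiZ !brE -lpiZ liebZr.
Qed.

Let lpi0 : lpi 0 = 0.
Proof. by apply: (addrI (lpi 0)); rewrite -lpiD !addr0. Qed.

Let brxx (x : liequot) : liequot_bracket x x = 0.
Proof. by elim/lpiP: x => u; rewrite brE liebb. Qed.

Let br_jacobi (x y z : liequot) :
  liequot_bracket (liequot_bracket x y) z
  + liequot_bracket (liequot_bracket y z) x
  + liequot_bracket (liequot_bracket z x) y = 0.
Proof.
by elim/lpiP: x => u; elim/lpiP: y => v; elim/lpiP: z => w;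
  rewrite !brE -!lpiD lieb_jacobi.
Qed.

HB.instance Definition _ := Lmodule_isLie.Build k liequot
  brDl brDr brZl brZr brxx br_jacobi.

Lemma lpiM u v : lpi (u *L v) = lpi u *L lpi v.
Proof. by rewrite -brE. Qed.

Lemma lpi_hom : is_lie_hom lpi.
Proof. by split; [exact: lpiD|exact: lpiZ|exact: lpiM]. Qed.

End LieQuotient.

(** * The free Lie algebra: formal expressions modulo the congruence generated
    by the axioms of Lie algebras *)

Section FreeLie.
Variables (k : fieldType) (X : Type).

Inductive lie_term :=
| LVar of X
| LZero
| LAdd of lie_term & lie_term
| LScale of k & lie_term
| LMul of lie_term & lie_term.

HB.instance Definition _ := gen_eqMixin lie_term.
HB.instance Definition _ := gen_choiceMixin lie_term.

Inductive lie_eqv : lie_term -> lie_term -> Prop :=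
| LE_refl t : lie_eqv t t
| LE_sym s t : lie_eqv s t -> lie_eqv t s
| LE_trans r s t : lie_eqv r s -> lie_eqv s t -> lie_eqv r t
| LE_add s s' t t' :
    lie_eqv s s' -> lie_eqv t t' -> lie_eqv (LAdd s t) (LAdd s' t')
| LE_scale c s s' : lie_eqv s s' -> lie_eqv (LScale c s) (LScale c s')
| LE_mul s s' t t' :
    lie_eqv s s' -> lie_eqv t t' -> lie_eqv (LMul s t) (LMul s' t')
| LE_addA r s t : lie_eqv (LAdd r (LAdd s t)) (LAdd (LAdd r s) t)
| LE_addC s t : lie_eqv (LAdd s t) (LAdd t s)
| LE_add0 t : lie_eqv (LAdd LZero t) t
| LE_addN t : lie_eqv (LAdd (LScale (-1) t) t) LZero
| LE_scaleA a b t : lie_eqv (LScale a (LScale b t)) (LScale (a * b) t)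
| LE_scale1 t : lie_eqv (LScale 1 t) t
| LE_scaleDr c s t :
    lie_eqv (LScale c (LAdd s t)) (LAdd (LScale c s) (LScale c t))
| LE_scaleDl a b t :
    lie_eqv (LScale (a + b) t) (LAdd (LScale a t) (LScale b t))
| LE_mulDl r s t : lie_eqv (LMul (LAdd r s) t) (LAdd (LMul r t) (LMul s t))
| LE_mulDr r s t : lie_eqv (LMul r (LAdd s t)) (LAdd (LMul r s) (LMul r t))
| LE_mulZl c s t : lie_eqv (LMul (LScale c s) t) (LScale c (LMul s t))
| LE_mulZr c s t : lie_eqv (LMul s (LScale c t)) (LScale c (LMul s t))
| LE_mulxx t : lie_eqv (LMul t t) LZero
| LE_jacobi r s t :
    lie_eqv (LAdd (LAdd (LMul (LMul r s) t) (LMul (LMul s t) r))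
                  (LMul (LMul t r) s)) LZero.

Definition lie_eqvb (s t : lie_term) : bool := `[< lie_eqv s t >].

Lemma lie_eqvb_equiv : equiv_class_of lie_eqvb.
Proof.
split=> [t|s t|s r t]; first exact/asboolP/LE_refl.
  by apply/asboolP/asboolP; apply: LE_sym.
by move=> /asboolP rs /asboolP st; apply/asboolP; apply: LE_trans rs st.
Qed.

Canonical lie_eqv_rel := EquivRelPack lie_eqvb_equiv.

Definition freelie := {eq_quot lie_eqv_rel}.

HB.instance Definition _ := Choice.on freelie.

Definition flpi (t : lie_term) : freelie := \pi_({eq_quot lie_eqv_rel}) t.

Lemma flpi_eq s t : flpi s = flpi t <-> lie_eqv s t.
Proof.
rewrite /flpi; split; first by move/eqmodP/asboolP.
by move=> st; apply/eqmodP/asboolP.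
Qed.

Lemma flpi_repr (x : freelie) : flpi (repr x) = x.
Proof. exact: reprK. Qed.

Let repr_flpi t : lie_eqv (repr (flpi t)) t.
Proof. by apply/flpi_eq; rewrite flpi_repr. Qed.

Let flpiP (P : freelie -> Prop) : (forall t, P (flpi t)) -> forall x, P x.
Proof. by move=> h x; rewrite -[x]flpi_repr. Qed.

Definition fl_zero : freelie := flpi LZero.
Definition fl_add (x y : freelie) : freelie := flpi (LAdd (repr x) (repr y)).
Definition fl_scale (c : k) (x : freelie) : freelie := flpi (LScale c (repr x)).
Definition fl_opp : freelie -> freelie := fl_scale (-1).
Definition fl_mul (x y : freelie) : freelie := flpi (LMul (repr x) (repr y)).

Let addE s t : fl_add (flpi s) (flpi t) = flpi (LAdd s t).
Proof. by apply/flpi_eq/LE_add. Qed.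
Let scaleE c t : fl_scale c (flpi t) = flpi (LScale c t).
Proof. by apply/flpi_eq/LE_scale. Qed.
Let mulE s t : fl_mul (flpi s) (flpi t) = flpi (LMul s t).
Proof. by apply/flpi_eq/LE_mul. Qed.

Let addA : associative fl_add.
Proof.
by elim/flpiP=> r; elim/flpiP=> s; elim/flpiP=> t; rewrite !addE;
  apply/flpi_eq/LE_addA.
Qed.

Let addC : commutative fl_add.
Proof.
by elim/flpiP=> s; elim/flpiP=> t; rewrite !addE; apply/flpi_eq/LE_addC.
Qed.

Let add0 : left_id fl_zero fl_add.
Proof. by elim/flpiP=> t; rewrite addE; apply/flpi_eq/LE_add0. Qed.

Let addN : left_inverse fl_zero fl_opp fl_add.
Proof.
by elim/flpiP=> t; rewrite /fl_opp scaleE addE; apply/flpi_eq/LE_addN.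
Qed.

HB.instance Definition _ := GRing.isZmodule.Build freelie addA addC add0 addN.

Let scaleA a b x : fl_scale a (fl_scale b x) = fl_scale (a * b) x.
Proof. by elim/flpiP: x => t; rewrite !scaleE; apply/flpi_eq/LE_scaleA. Qed.

Let scale1 : left_id 1 fl_scale.
Proof. by elim/flpiP=> t; rewrite scaleE; apply/flpi_eq/LE_scale1. Qed.

Let scaleDr : right_distributive fl_scale fl_add.
Proof.
by move=> c; elim/flpiP=> s; elim/flpiP=> t; rewrite !(addE, scaleE);
  apply/flpi_eq/LE_scaleDr.
Qed.

Let scaleDl x : {morph fl_scale^~ x : a b / a + b >-> fl_add a b}.
Proof.
by move=> a b; elim/flpiP: x => t; rewrite !scaleE addE;
  apply/flpi_eq/LE_scaleDl.
Qed.

HB.instance Definition _ := GRing.Zmodule_isLmodule.Build k freelie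
  scaleA scale1 scaleDr scaleDl.

Let mulDl x y z : fl_mul (fl_add x y) z = fl_add (fl_mul x z) (fl_mul y z).
Proof.
by elim/flpiP: x => r; elim/flpiP: y => s; elim/flpiP: z => t;
  rewrite !(addE, mulE); apply/flpi_eq/LE_mulDl.
Qed.

Let mulDr x y z : fl_mul x (fl_add y z) = fl_add (fl_mul x y) (fl_mul x z).
Proof.
by elim/flpiP: x => r; elim/flpiP: y => s; elim/flpiP: z => t;
  rewrite !(addE, mulE); apply/flpi_eq/LE_mulDr.
Qed.

Let mulZl c x y : fl_mul (fl_scale c x) y = fl_scale c (fl_mul x y).
Proof.
by elim/flpiP: x => s; elim/flpiP: y => t; rewrite !(scaleE, mulE);
  apply/flpi_eq/LE_mulZl.
Qed.

Let mulZr c x y : fl_mul x (fl_scale c y) = fl_scale c (fl_mul x y).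
Proof.
by elim/flpiP: x => s; elim/flpiP: y => t; rewrite !(scaleE, mulE);
  apply/flpi_eq/LE_mulZr.
Qed.

Let mulxx x : fl_mul x x = fl_zero.
Proof. by elim/flpiP: x => t; rewrite mulE; apply/flpi_eq/LE_mulxx. Qed.

Let mul_jacobi x y z :
  fl_add (fl_add (fl_mul (fl_mul x y) z) (fl_mul (fl_mul y z) x))
         (fl_mul (fl_mul z x) y) = fl_zero.
Proof.
by elim/flpiP: x => r; elim/flpiP: y => s; elim/flpiP: z => t;
  rewrite !(addE, mulE); apply/flpi_eq/LE_jacobi.
Qed.

HB.instance Definition _ := Lmodule_isLie.Build k freelie
  mulDl mulDr mulZl mulZr mulxx mul_jacobi.

Lemma flpiD s t : flpi (LAdd s t) = flpi s + flpi t.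
Proof. by rewrite -addE. Qed.

Lemma flpiZ c t : flpi (LScale c t) = c *: flpi t.
Proof. by rewrite -scaleE. Qed.

Lemma flpiM s t : flpi (LMul s t) = flpi s *L flpi t.
Proof. by rewrite -mulE. Qed.

Definition flgen (x : X) : freelie := flpi (LVar x).

Section Lift.
Variables (A : lieAlgType k) (phi : X -> A).

Fixpoint lie_eval (t : lie_term) : A :=
  match t with
  | LVar x => phi x
  | LZero => 0
  | LAdd s t => lie_eval s + lie_eval t
  | LScale c t => c *: lie_eval t
  | LMul s t => lie_eval s *L lie_eval t
  end.

Lemma lie_evalP s t : lie_eqv s t -> lie_eval s = lie_eval t.
Proof.
elim=> //= *; first [congruence | rewrite ?scaleN1r].
all: rewrite ?(addrA, add0r, addNr, scalerA, scale1r, scalerDr, scalerDl) //.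
all: rewrite ?(liebDl, liebDr, liebZl, liebZr, liebb, lieb_jacobi) //.
exact: addrC.
Qed.

Definition freelie_lift (x : freelie) : A := lie_eval (repr x).

Lemma freelie_liftE t : freelie_lift (flpi t) = lie_eval t.
Proof. exact: lie_evalP. Qed.

Lemma freelie_lift_hom : is_lie_hom freelie_lift.
Proof.
by split; [elim/flpiP=> s; elim/flpiP=> t|move=> c; elim/flpiP=> t|
  elim/flpiP=> s; elim/flpiP=> t];
  rewrite -?(flpiD, flpiZ, flpiM) !freelie_liftE.
Qed.

Lemma freelie_lift_gen x : freelie_lift (flgen x) = phi x.
Proof. exact: freelie_liftE. Qed.

End Lift.
End FreeLie.

(** * The free metabelian Lie algebra Lie(X) / Lie(X)^(2) *)

Lemma lie_hom0 (k : fieldType) (L M : lieAlgType k) (h : L -> M) :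
  is_lie_hom h -> h 0 = 0.
Proof. by case=> _ hZ _; rewrite -(scale0r (0 : L)) hZ scale0r. Qed.

Lemma lie_hom_derived (k : fieldType) (L M : lieAlgType k) (h : L -> M) :
  is_lie_hom h -> forall n u, derived L n u -> derived M n (h u).
Proof.
move=> hh; have [hD hZ hM] := hh; elim=> // n IHn _ [m [c [v [Dv ->]]]].
exists m, c, (h \o v); split=> [i|] /=.
  have [a Da [b Db <-]] := Dv i; rewrite hM.
  by exists (h a); [exact: IHn|exists (h b); [exact: IHn|]].
rewrite (big_morph h hD (lie_hom0 hh)).
by apply: eq_bigr => i _; rewrite hZ.
Qed.

Lemma liequot_derived (k : fieldType) (L : lieAlgType k) (I : set L)
    (idI : is_ideal I) n (x : liequot idI) :
  derived (liequot idI) n x -> exists2 u, derived L n u & lpi idI u = x.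
Proof.
have [hD hZ hM] := lpi_hom idI.
elim: n x => [|n IHn] x; first by exists (repr x) => //; exact: lpi_repr.
move=> [m [c [v [Dv ->]]]].
have /choice[w wP] i : exists w, [set a *L b | a in derived L n
    & b in derived L n] w /\ lpi idI w = v i.
  have [a /IHn[a' Da' <-] [b /IHn[b' Db' <-] <-]] := Dv i.
  by exists (a' *L b'); split; [exists a' => //; exists b'|rewrite hM].
exists (\sum_(i < m) c i *: w i).
  by exists m, c, w; split=> // i; case: (wP i).
rewrite (big_morph _ hD (lie_hom0 (lpi_hom idI))).
by apply: eq_bigr => i _; rewrite hZ (wP i).2.
Qed.

Definition L2 (k : fieldType) (X : Type) :=
  liequot (derived_ideal (freelie k X) 2).

Definition l2gen (k : fieldType) (X : Type) (x : X) : L2 k X :=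
  lpi (derived_ideal (freelie k X) 2) (flgen k x).

Lemma L2_metabelian (k : fieldType) (X : Type) (f : L2 k X) :
  derived (L2 k X) 2 f -> f = 0.
Proof.
move=> /liequot_derived[u Du <-].
rewrite -(lie_hom0 (lpi_hom (derived_ideal (freelie k X) 2))).
by apply/lpi_eq; rewrite subr0.
Qed.

Section L2Map.
Variables (k : fieldType) (X Y : Type) (phi : X -> Y).

(* The homomorphism of Lie algebras induced by a map between the generators;
   [repr] picks a preimage in the free Lie algebra, the choice of which is
   irrelevant by l2mapE. *)
Definition l2map (f : L2 k X) : L2 k Y :=
  freelie_lift (fun x => l2gen k (phi x)) (repr f).

Lemma l2mapE u :
  l2map (lpi _ u) = freelie_lift (fun x => l2gen k (phi x)) u.
Proof.
set h := freelie_lift _; have hh : is_lie_hom h := freelie_lift_hom _.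
have [hD hZ _] := hh; apply/eqP; rewrite -subr_eq0 -scaleN1r -hZ -hD scaleN1r.
apply/eqP/L2_metabelian/(lie_hom_derived hh).
by apply/(lpi_eq (derived_ideal (freelie k X) 2)); rewrite lpi_repr.
Qed.

Lemma l2map_gen x : l2map (l2gen k x) = l2gen k (phi x).
Proof. by rewrite l2mapE freelie_lift_gen. Qed.

Lemma l2map_hom : is_lie_hom l2map.
Proof.
have [hD hZ hM] := freelie_lift_hom (fun x => l2gen k (phi x)).
have [pD pZ pM] := lpi_hom (derived_ideal (freelie k X) 2).
have lP (f : L2 k X) : exists u, f = lpi _ u.
  by exists (repr f); rewrite lpi_repr.
split=> [f g|c f|f g].
- have [u ->] := lP f; have [v ->] := lP g.
  by rewrite -pD (l2mapE (u + v)) (l2mapE u) (l2mapE v) hD.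
- by have [u ->] := lP f; rewrite -pZ (l2mapE (c *: u)) (l2mapE u) hZ.
- have [u ->] := lP f; have [v ->] := lP g.
  by rewrite -pM (l2mapE (u *L v)) (l2mapE u) (l2mapE v) hM.
Qed.

End L2Map.

(** * Regular words *)

Section Words.
Variables (d : Order.disp_t) (X : orderType d).
Implicit Types (u v w : seq X).

(* The word a_0 a_1 ... a_n is the sequence [:: a_0; a_1; ...; a_n]. *)
Definition inR w :=
  if w is a0 :: (a1 :: _) as t then (a1 < a0)%O && sorted <=%O t else false.

Definition inN w := (size w == 1%N) || inR w.

Definition deglex_lt u v :=
  (size u < size v)%N
  || (size u == size v) && ((u : seqlexi X) < (v : seqlexi X))%O.

Definition deglex_max u v := if deglex_lt u v then v else u.

Definition osort (s : seq X) : seq X := sort <=%O s.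

End Words.

Section Polynomials.
Variables (k : fieldType) (d : Order.disp_t) (X : orderType d).
Local Notation L := (L2 k X).
Implicit Types (f g h s : L) (S T : set L) (u v w : seq X) (a b c : X).

(* f c_1 ... c_r, left-normed *)
Definition lmul f (t : seq X) : L := foldl (fun g c => g *L l2gen k c) f t.

Definition wordL w : L := if w is a :: t then lmul (l2gen k a) t else 0.

(* c is the coordinate vector of f in the basis N. *)
Definition is_expansion f (c : {fsfun seq X -> k with 0}) :=
  all (@inN d X) (finsupp c) /\ f = \sum_(w <- finsupp c) c w *: wordL w.

Definition expansion f : {fsfun seq X -> k with 0} :=
  xget [fsfun] [set c | is_expansion f c].

Definition coef f w : k := expansion f w.

Definition supp f : seq (seq X) := finsupp (expansion f).

(* The empty sequence is not a word and is deglex-smaller than every word, so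
   lead 0 = [::] satisfies none of the conditions on leading words below. *)
Definition lead f : seq X := \big[@deglex_max d X/[::]]_(w <- supp f) w.

Definition lcoef f : k := coef f (lead f).

Definition monicL f := f != 0 /\ lcoef f = 1.

Definition part0 f : L :=
  \sum_(w <- supp f | size w == 1%N) coef f w *: wordL w.
Definition part1 f : L :=
  \sum_(w <- supp f | inR w) coef f w *: wordL w.

Definition coef0 f : k := coef f (lead (part0 f)).

Inductive normal_word S : L -> Prop :=
| NormalLetters s t :
    S s -> sorted <=%O t -> (if t is a :: _ then lead s != [:: a] else true) ->
    normal_word S (lmul s t)
| NormalWord u s :
    S s -> inR u -> lead s != u -> normal_word S (wordL u *L s).

(* f = 0 mod (S, w) *)
Definition trivial_mod S w f :=
  lspan [set h | [/\ normal_word S h, h != 0 & deglex_lt (lead h) w]] f.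

(* [composition f g w h]: h is a composition of f and g with respect to w *)
Inductive composition f g : seq X -> L -> Prop :=
| CompI a0 u v (m : {mset X}%mset) :
    lead f = a0 :: u -> lead g = a0 :: v ->
    m = msetU (seq_mset u) (seq_mset v) ->
    composition f g (a0 :: osort m)
      (lmul f (osort (msetB m (seq_mset u)))
       - lmul g (osort (msetB m (seq_mset v))))
  (* a_i is the letter b; i = 1 when u is empty *)
| CompII a0 u b v :
    lead f = a0 :: u ++ b :: v -> lead (part1 f) = lead f ->
    lead (part0 g) = [:: b] ->
    (u != [::]) || (if v is a2 :: _ then (a2 < a0)%O else false) ->
    composition f g (lead f)
      (f - (coef0 g)^-1 *: (wordL (a0 :: u ++ v) *L g))
| CompIII a0 a1 v :
    lead f = [:: a0, a1 & v] -> lead (part1 f) = lead f ->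
    lead g = [:: a1] -> lead (part0 g) = lead g ->
    (if v is a2 :: _ then (a0 <= a2)%O else true) ->
    composition f g (lead f) (f + lmul g (a0 :: v))
| CompIV a0 a1 v a :
    lead f = [:: a0, a1 & v] -> lead (part1 f) = lead f ->
    part1 g != 0 -> lead (part0 g) = [:: a1] ->
    (if v is a2 :: _ then (a0 <= a2)%O else true) -> (a < a0)%O ->
    composition f g (a0 :: osort [:: a, a1 & v])
      (f *L l2gen k a
       - (coef0 g)^-1 *: (wordL [:: a0, a & v] *L g))
| CompV a0 u b :
    lead f = a0 :: u -> lead (part1 f) = lead f -> part0 f != 0 ->
    part1 g != 0 -> lead (part0 g) = [:: b] -> b \notin u ->
    composition f g (a0 :: osort (b :: u))
      (f *L l2gen k b
       - (coef0 g)^-1 *: (wordL (a0 :: u) *L g))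
| CompVI a a0 a1 :
    lead (part0 f) = [:: a] -> lead (part0 g) = [:: a] -> part1 f != 0 ->
    (a1 < a0)%O ->
    composition f g (a0 :: osort [:: a1; a])
      (wordL [:: a0; a1] *L
       ((coef0 f)^-1 *: f - (coef0 g)^-1 *: g))
| CompVII a b a0 :
    part1 f != 0 -> part1 g != 0 ->
    lead (part0 f) = [:: a] -> lead (part0 g) = [:: b] -> (b < a)%O ->
    (a < a0)%O ->
    composition f g [:: a0; b; a]
      ((coef0 f)^-1 *: (wordL [:: a0; b] *L f)
       - (coef0 g)^-1 *: (wordL [:: a0; a] *L g)).

Definition gs_basis S :=
  (forall f, S f -> monicL f) /\
  forall f g w h, S f -> S g -> composition f g w h -> trivial_mod S w h.

Definition Id S : set L := smallest (@is_ideal k L) S.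

(* T is a Groebner-Shirshov basis for the algebra presented by S, that is for
   the quotient of L by Id S. *)
Definition gs_basis_for S T := gs_basis T /\ Id T = Id S.

Definition nontrivial_compositions S : set L :=
  [set r | exists f g w h,
    [/\ S f, S g, composition f g w h, ~ trivial_mod S w h
      & r = (lcoef h)^-1 *: h]].

(* The set reached before stage i, when U j is adjoined at stage j. *)
Definition shirshov_stage S di (J : orderType di) (U : J -> set L) (i : J) :=
  S `|` \bigcup_(j in [set j | (j < i)%O]) U j.

(* T is obtained from S by a (possibly transfinite) run of Shirshov's algorithm;
   each stage adjoins any number of normalized nontrivial compositions of the current set. *)
Definition shirshov_run S T :=
  exists di (J : orderType di) (U : J -> set L),
    [/\ well_founded (fun i j : J => (i < j)%O),
        forall i, U i `<=` nontrivial_compositions (shirshov_stage S U i)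
      & T = S `|` \bigcup_(i in setT) U i].

Definition gs_complement S T := gs_basis_for S T /\ shirshov_run S T.

End Polynomials.

(* Main.v *)
(** Since [S_i] lies in the derived algebra, so do the ideal [Id S_i] and its
    complement [SC_i]; all linear parts vanish there, and type I is the only
    composition that can occur.  It requires two leading words with the same
    first letter, so both polynomials come from the same side, and their
    composition is the image of a composition over [X_i], whose triviality is
    transported along the order embedding of the letters.

    Transporting leading words needs the regular words to be a basis.  Linear
    independence comes from a Magnus embedding: sending [x] to
    [(x, [x = a])] in the semidirect product of [k[X]] with itself, the regular
    word [a_0 a_1 ... a_n] has second component
    [[a_0 = a] a_1 a_2 ... a_n - [a_1 = a] a_0 a_2 ... a_n], and the second term
    cannot be read off at a regular word because [a_1] is its least letter. *)
Require Import Defs.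
From HB Require Import structures.
From mathcomp Require Import all_boot all_order all_algebra.
From mathcomp Require Import finmap multiset monalg.
From mathcomp Require Import boolp classical_sets.

Local Open Scope classical_set_scope.

Set Implicit Arguments.
Unset Strict Implicit.
Unset Printing Implicit Defensive.

Import Order.TTheory GRing.Theory.

(** * Universal property of the free metabelian Lie algebra *)

Section L2Lift.
Local Open Scope ring_scope.
Variables (k : fieldType) (X : Type).
Implicit Types (f g : L2 k X).

(** An element is the class, modulo the second derived ideal, of the class of a formal expression,
    so induction on that expression suffices. *)
Lemma L2_ind (P : L2 k X -> Prop) :
  (forall x, P (l2gen k x)) -> P 0 ->
  (forall f g, P f -> P g -> P (f + g)) ->
  (forall c f, P f -> P (c *: f)) ->
  (forall f g, P f -> P g -> P (f *L g)) -> forall f, P f.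
Proof.
move=> Pgen P0 PD PZ PM f; rewrite -[f]lpi_repr.
set I := derived_ideal _ 2; have [hD hZ hM] := lpi_hom I.
rewrite -[repr f]flpi_repr.
elim: (repr (repr f)) => [x||s Ps t Pt|c t Pt|s Ps t Pt].
- exact: Pgen.
- by rewrite -[flpi _]/(0 : freelie k X) (lie_hom0 (lpi_hom I)).
- by rewrite flpiD hD; apply: PD.
- by rewrite flpiZ hZ; apply: PZ.
- by rewrite flpiM hM; apply: PM.
Qed.

Variables (A : lieAlgType k) (phi : X -> A).

Definition l2lift f : A := freelie_lift phi (repr f).

Hypothesis A_metabelian : forall a, derived A 2 a -> a = 0.

(** Two preimages of the same element differ by an element of the second derived ideal. A
    homomorphism sends it into that of [A], which is zero, so the choice made by [repr] does not
    matter. *)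
Lemma l2liftE u : l2lift (lpi _ u) = freelie_lift phi u.
Proof.
set h := freelie_lift _; have hh : is_lie_hom h := freelie_lift_hom _.
have [hD hZ _] := hh; apply/eqP; rewrite -subr_eq0 -scaleN1r -hZ -hD scaleN1r.
apply/eqP/A_metabelian/(lie_hom_derived hh).
by apply/(lpi_eq (derived_ideal (freelie k X) 2)); rewrite lpi_repr.
Qed.

Lemma l2lift_gen x : l2lift (l2gen k x) = phi x.
Proof. by rewrite l2liftE freelie_lift_gen. Qed.

Lemma l2lift_hom : is_lie_hom l2lift.
Proof.
have [hD hZ hM] := freelie_lift_hom phi.
have [pD pZ pM] := lpi_hom (derived_ideal (freelie k X) 2).
have lP f : exists u, f = lpi _ u by exists (repr f); rewrite lpi_repr.
split=> [f g|c f|f g]; have [u ->] := lP f; try have [v ->] := lP g.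
- by rewrite -pD (l2liftE (u + v)) (l2liftE u) (l2liftE v) hD.
- by rewrite -pZ (l2liftE (c *: u)) (l2liftE u) hZ.
- by rewrite -pM (l2liftE (u *L v)) (l2liftE u) (l2liftE v) hM.
Qed.

End L2Lift.

(* The semidirect product of the abelian Lie algebra P with the P-module P. *)
Definition magnus (k : fieldType) (P : comAlgType k) : Type := (P * P)%type.

(** * Target of the Magnus embedding *)

Section Magnus.
Local Open Scope ring_scope.
Variables (k : fieldType) (P : comAlgType k).

HB.instance Definition _ := GRing.Lmodule.copy (magnus P) (P * P)%type.

Definition magnus_bracket (u v : magnus P) : magnus P :=
  (0, u.2 * v.1 - v.2 * u.1).

Let brDl u v w :
  magnus_bracket (u + v) w = magnus_bracket u w + magnus_bracket v w.
Proof.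
apply: injective_projections; rewrite /= ?addr0 //.
by rewrite !mulrDl !mulrDr opprD addrACA.
Qed.

Let brDr u v w :
  magnus_bracket u (v + w) = magnus_bracket u v + magnus_bracket u w.
Proof.
apply: injective_projections; rewrite /= ?addr0 //.
by rewrite !mulrDl !mulrDr opprD addrACA.
Qed.

Let brZl c u v : magnus_bracket (c *: u) v = c *: magnus_bracket u v.
Proof.
apply: injective_projections; rewrite /= ?scaler0 //.
by rewrite scalerBr -scalerAl -scalerAr.
Qed.

Let brZr c u v : magnus_bracket u (c *: v) = c *: magnus_bracket u v.
Proof.
apply: injective_projections; rewrite /= ?scaler0 //.
by rewrite scalerBr -scalerAl -scalerAr.
Qed.

Let brxx u : magnus_bracket u u = 0.
Proof. by apply: injective_projections; rewrite /= ?subrr. Qed.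

Let br_jacobi u v w :
  magnus_bracket (magnus_bracket u v) w + magnus_bracket (magnus_bracket v w) u
  + magnus_bracket (magnus_bracket w u) v = 0.
Proof.
apply: injective_projections; rewrite /= ?addr0 // !mulr0 !subr0 !mulrBl.
(* Exchanging the last two factors in the second, fourth and sixth terms makes them cancel the
   third, fifth and first. *)
rewrite (mulrAC v.2 u.1) (mulrAC w.2 v.1) (mulrAC u.2 w.1).
by rewrite [LHS](AC (2*2*2) ((1*6)*(3*2)*(5*4))) /= !subrr !addr0.
Qed.

HB.instance Definition _ := Lmodule_isLie.Build k (magnus P)
  brDl brDr brZl brZr brxx br_jacobi.

Lemma magnus_bracketE (u v : magnus P) : u *L v = (0, u.2 * v.1 - v.2 * u.1).
Proof. by []. Qed.

Lemma magnus_derived1 (u : magnus P) : derived (magnus P) 1 u -> u.1 = 0.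
Proof.
case=> n [c [v [Dv ->]]].
rewrite (big_morph (fst : magnus P -> P) (id1 := 0) (op1 := +%R)) //.
rewrite big1 // => i _ /=; have [a _ [b _ <-]] := Dv i.
by rewrite magnus_bracketE /= scaler0.
Qed.

(** The elements with zero first component form an abelian ideal that contains all brackets. *)
Lemma magnus_metabelian (u : magnus P) : derived (magnus P) 2 u -> u = 0.
Proof.
case=> n [c [v [Dv ->]]]; rewrite big1 // => i _.
have [a Da [b Db <-]] := Dv i; rewrite magnus_bracketE.
by rewrite (magnus_derived1 Da) (magnus_derived1 Db) !mulr0 subrr scaler0.
Qed.

End Magnus.

(** * The degree-lexicographic maximum as a commutative monoid law *)

Section Words.
Variables (d : Order.disp_t) (X : orderType d).
Implicit Types u v w : seq X.

(** Pairing a word with its length turns the order into a lexicographic product, from which the laws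
    of [deglex_max] are inherited. *)
Lemma deglex_ltE u v :
  deglex_lt u v = (((size u, u) : nat *l seqlexi X) < (size v, v))%O.
Proof. by rewrite ltxi_pair /deglex_lt leEnat; case: ltngtP. Qed.

Lemma deglex_maxE u v :
  (size (deglex_max u v), deglex_max u v)
  = Order.max ((size u, u) : nat *l seqlexi X) (size v, v).
Proof. by rewrite /deglex_max deglex_ltE maxElt; case: ifP. Qed.

Lemma deglex_maxA : associative (@deglex_max d X).
Proof.
move=> u v w.
suff [] : (size (deglex_max u (deglex_max v w)), deglex_max u (deglex_max v w))
  = (size (deglex_max (deglex_max u v) w), deglex_max (deglex_max u v) w) by [].
by rewrite !deglex_maxE maxA.
Qed.

Lemma deglex_maxC : commutative (@deglex_max d X).
Proof.
move=> u v.
suff [] : (size (deglex_max u v), deglex_max u v)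
  = (size (deglex_max v u), deglex_max v u) by [].
by rewrite !deglex_maxE maxC.
Qed.

Lemma deglex_max0 : left_id [::] (@deglex_max d X).
Proof. by case=> [|a u]. Qed.

HB.instance Definition _ := Monoid.isComLaw.Build (seq X) [::] (@deglex_max d X)
  deglex_maxA deglex_maxC deglex_max0.

Lemma inR_inN w : inR w -> inN w.
Proof. by rewrite /inN => ->; rewrite orbT. Qed.

End Words.

(** * Regular words span the free metabelian Lie algebra *)

Section Spanning.
Local Open Scope ring_scope.
Variables (k : fieldType) (d : Order.disp_t) (X : orderType d).
Local Notation L := (L2 k X).
Implicit Types (f g : L) (s t w : seq X) (a b x y : X).

Lemma derived1_bracket f g : derived L 1 (f *L g).
Proof. by apply: lspan_sub; exists f => //; exists g. Qed.

(** In the Jacobi identity the term pairing [f] with the bracket of the two letters lies in the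
    second derived algebra, hence vanishes. So letters act on the derived algebra by commuting
    operators. *)
Lemma derived1_gen2C f a b : derived L 1 f ->
  f *L l2gen k a *L l2gen k b = f *L l2gen k b *L l2gen k a.
Proof.
move=> Df; apply/eqP; rewrite -subr_eq0 -liebNl -liebNr.
have := lieb_jacobi f (l2gen k a) (l2gen k b).
have -> : l2gen k a *L l2gen k b *L f = 0.
  apply: L2_metabelian; apply: lspan_sub.
  by exists (l2gen k a *L l2gen k b); [exact: derived1_bracket|exists f].
by rewrite addr0 (liebC (l2gen k b) f) liebNl liebNr liebNl => ->.
Qed.

Lemma lmul_cons f a t : lmul f (a :: t) = lmul (f *L l2gen k a) t.
Proof. by []. Qed.

Lemma derived1_lmul f t : derived L 1 f -> derived L 1 (lmul f t).
Proof.
elim: t f => // a t IHt f Df; rewrite lmul_cons; apply: IHt.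
exact: derived1_bracket.
Qed.

Lemma lmul_cat f s t : lmul f (s ++ t) = lmul (lmul f s) t.
Proof. exact: foldl_cat. Qed.

Lemma lmulD f g t : lmul (f + g) t = lmul f t + lmul g t.
Proof. by elim: t f g => // a t IHt f g; rewrite !lmul_cons liebDl IHt. Qed.

Lemma lmulN f t : lmul (- f) t = - lmul f t.
Proof. by elim: t f => // a t IHt f; rewrite !lmul_cons liebNl IHt. Qed.

Lemma lmul_genC f a t : derived L 1 f ->
  lmul (f *L l2gen k a) t = lmul f t *L l2gen k a.
Proof.
elim: t f => // b t IHt f Df.
by rewrite !lmul_cons derived1_gen2C // IHt //; apply: derived1_bracket.
Qed.

Lemma lmulC f s t : derived L 1 f -> lmul (lmul f s) t = lmul (lmul f t) s.
Proof.
elim: s f => // a s IHs f Df.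
by rewrite !lmul_cons IHs ?(lmul_genC _ t) //; apply: derived1_bracket.
Qed.

Lemma lmul_perm f s t : derived L 1 f -> perm_eq s t -> lmul f s = lmul f t.
Proof.
move=> Df; apply: catCA_perm_subst => t1 t2 t3.
by rewrite !lmul_cat (lmulC _ _ Df).
Qed.

Local Notation V := (lspan [set wordL k w | w in [set w | inN w]]).

(** Sorting the tail gives a regular word, because [y] is at most every letter of [t] and may stay
    in front. *)
Lemma span_sorted x y t : (y < x)%O -> all (>= y)%O t ->
  V (lmul (l2gen k x *L l2gen k y) t).
Proof.
move=> yx yt; rewrite (lmul_perm (t := osort t)); last 2 first.
- exact: derived1_bracket.
- by rewrite perm_sym perm_sort.
apply: lspan_sub; exists [:: x, y & osort t] => //; apply: inR_inN => /=.
rewrite yx path_min_sorted ?sort_le_sorted //.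
by rewrite (perm_all _ (permEl (perm_sort _ _))).
Qed.

(** Once [y < x] and the tail is sorted, the only obstruction is a first tail letter [b] below [y].
    The Jacobi identity then gives two products with [b] in second place, where it is the least
    letter. *)
Lemma span_lmul2 x y t : V (lmul (l2gen k x *L l2gen k y) t).
Proof.
wlog yx : x y / (y < x)%O => [IH|].
  case: (ltgtP y x) => [/IH //|xy|->].
    by rewrite liebC lmulN -scaleN1r; apply: lspanZ; apply: IH.
  rewrite liebb; have -> : lmul 0 t = 0 :> L.
    by elim: (t) => //= a u; rewrite lieb0l.
  exact: lspan0.
have Dxy := derived1_bracket (l2gen k x) (l2gen k y).
have st : perm_eq t (osort t) by rewrite perm_sym perm_sort.
rewrite (lmul_perm Dxy st); have := sort_le_sorted t; rewrite -/(osort t).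
case: (osort t) => [_|b s /= bs]; first exact: span_sorted.
have {bs} bs : all (>= b)%O s by apply: order_path_min bs; apply: le_trans.
have [yb|by_] := leP y b.
  apply: (span_sorted (t := b :: s)) => //=; rewrite yb /=.
  by apply: sub_all bs => c; apply: le_trans.
have -> : l2gen k x *L l2gen k y *L l2gen k b
    = l2gen k x *L l2gen k b *L l2gen k y - l2gen k y *L l2gen k b *L l2gen k x.
  have /eqP := lieb_jacobi (l2gen k x) (l2gen k y) (l2gen k b).
  rewrite -addrA addr_eq0 => /eqP ->.
  by rewrite opprD addrC (liebC (l2gen k b)) liebNl opprK.
rewrite lmulD lmulN -scaleN1r; apply: lspanD; last apply: lspanZ.
  apply: (span_sorted (t := y :: s)); first exact: lt_trans yx.
  by rewrite /= (ltW by_).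
apply: (span_sorted (t := x :: s)) => //=.
by rewrite (ltW (lt_trans by_ yx)).
Qed.

Lemma span_mul_gen f b : V f -> V (f *L l2gen k b).
Proof.
move=> [n [c [v [Nv ->]]]]; rewrite lieb_suml; apply: lspan_sum => i.
rewrite liebZl; apply: lspanZ; have [w _ <-] := Nv i.
case: w => [|x [|y t]]; first by rewrite lieb0l; apply: lspan0.
  exact: (span_lmul2 x b [::]).
have -> : wordL k [:: x, y & t] *L l2gen k b
    = lmul (l2gen k x *L l2gen k y) (rcons t b).
  by rewrite -cats1 lmul_cat.
exact: span_lmul2.
Qed.

(** The induction also carries stability of the span under right multiplication by [f]. The Jacobi
    identity writes multiplication by a bracket as a commutator of multiplications, which settles
    the bracket case. *)
Lemma span_words f : V f.
Proof.
suff [] : V f /\ forall g, V g -> V (g *L f) by [].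
elim/L2_ind: f => [x||f g [Vf Mf] [Vg Mg]|c f [Vf Mf]|f g [Vf Mf] [Vg Mg]].
- split=> [|g]; last exact: span_mul_gen.
  by apply: lspan_sub; exists [:: x].
- by split=> [|g Vg]; rewrite ?lieb0r; apply: lspan0.
- split=> [|h Vh]; first exact: lspanD.
  by rewrite liebDr; apply: lspanD; [apply: Mf|apply: Mg].
- split=> [|h Vh]; first exact: lspanZ.
  by rewrite liebZr; apply: lspanZ; apply: Mf.
- split=> [|h Vh]; first exact: Mg.
  have -> : h *L (f *L g) = h *L f *L g - h *L g *L f.
    rewrite liebC; have /eqP := lieb_jacobi f g h.
    rewrite -addrA addr_eq0 => /eqP ->; rewrite opprK addrC; congr (_ + _).
    by rewrite (liebC g h) liebNl.
  rewrite -scaleN1r; apply: lspanD; first exact/Mg/Mf.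
  exact/lspanZ/Mf/Mg.
Qed.

End Spanning.

(** * Polynomial algebra and its coefficient forms *)

Section MonomialForms.
Local Open Scope ring_scope.
Variables (k : fieldType) (X : choiceType).
Local Notation P := {malg k[{cmonom X}]}.

Let monom (t : seq X) : {cmonom X} := \big[mmul/mone]_(a <- t) ucm a.

Let monomE t a : monom t a = count_mem a t.
Proof.
rewrite /monom; elim: t => [|b t IHt]; first by rewrite big_nil cm1.
by rewrite big_cons cmM cmU IHt.
Qed.

Let malgMUU (m n : {cmonom X}) : << m >> * << n >> = << mmul m n >> :> P.
Proof. by rewrite malgM_def fgmulUU mulr1. Qed.

Let prodE t : \prod_(a <- t) << ucm a >> = << monom t >> :> P.
Proof.
rewrite /monom; elim: t => [|b t IHt].
  by rewrite [LHS]big_nil [in RHS]big_nil.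
rewrite [LHS]big_cons [in RHS]big_cons IHt; exact: malgMUU.
Qed.

Let monom_eq s t : (monom s == monom t) = perm_eq s t.
Proof.
apply/eqP/idP => [st|st]; last exact: perm_big.
by apply/allP => a _ /=; rewrite -!monomE st.
Qed.

HB.instance Definition _ (m : {cmonom X}) :=
  GRing.isScalable.Build k P k *%R (mcoeff m) (fun c g => mcoeffZ c g m).

(** Witnessed by the polynomial algebra on [X]: [e] gives the variables and [l t] reads the
    coefficient of the monomial of [t]. Later computations see only this interface. *)
Lemma monomial_forms_exist : exists (P : comAlgType k) (e : X -> P)
    (l : seq X -> {scalar P}),
  forall s t, l t (\prod_(a <- s) e a) = (perm_eq s t)%:R.
Proof.
exists P, (fun a => << ucm a >>), (fun t => mcoeff (monom t) : {scalar P}).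
by move=> s t; rewrite prodE /= mcoeffU1 monom_eq.
Qed.

End MonomialForms.

(** * Functionals dual to the regular words *)

Section Coordinates.
Local Open Scope ring_scope.
Variables (k : fieldType) (d : Order.disp_t) (X : orderType d).
Local Notation L := (L2 k X).
Variables (P : comAlgType k) (e : X -> P) (l : seq X -> {scalar P}).
Hypothesis l_prod : forall s t, l t (\prod_(a <- s) e a) = (perm_eq s t)%:R.
Implicit Types (f g : L) (s t u v w : seq X) (a b x y : X).

Definition magnus_gen a x : magnus P := (e x, (x == a)%:R).

Definition magnus_map a f : magnus P := l2lift (magnus_gen a) f.

Lemma magnus_map_hom a : is_lie_hom (magnus_map a).
Proof. exact/l2lift_hom/magnus_metabelian. Qed.

Lemma magnus_map_gen a x : magnus_map a (l2gen k x) = magnus_gen a x.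
Proof. exact/l2lift_gen/magnus_metabelian. Qed.

Lemma magnus_map_derived1 a f : derived L 1 f -> (magnus_map a f).1 = 0.
Proof. by move/(lie_hom_derived (magnus_map_hom a))/magnus_derived1. Qed.

(** On the derived algebra the first component is zero, so bracketing with a letter only multiplies
    the second component by its variable. *)
Lemma magnus_map_lmul a f t : derived L 1 f ->
  (magnus_map a (lmul f t)).2 = (magnus_map a f).2 * \prod_(b <- t) e b.
Proof.
have [_ _ hM] := magnus_map_hom a.
elim: t f => [|b t IHt] f Df; first by rewrite big_nil mulr1.
rewrite lmul_cons IHt; last exact: derived1_bracket.
rewrite hM magnus_bracketE magnus_map_gen (magnus_map_derived1 a Df) /=.
by rewrite mulr0 subr0 -mulrA big_cons.
Qed.

Lemma magnus_map_word a x y t : (magnus_map a (wordL k [:: x, y & t])).2 =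
  (\prod_(b <- y :: t) e b) *+ (x == a) - (\prod_(b <- x :: t) e b) *+ (y == a).
Proof.
have [_ _ hM] := magnus_map_hom a.
rewrite [wordL _ _]lmul_cons magnus_map_lmul; last exact: derived1_bracket.
rewrite hM !magnus_map_gen magnus_bracketE /= mulrBl -!mulrA !mulr_natl.
by rewrite !big_cons.
Qed.

(** The first letter selects the Magnus map, the tail selects the monomial. Words of length one are
    read in the first component, which vanishes on the derived algebra. *)
Definition coord w f : k :=
  if w is a :: t then
    if t is [::] then l [:: a] (magnus_map a f).1 else l t (magnus_map a f).2
  else 0.

Lemma coordD w f g : coord w (f + g) = coord w f + coord w g.
Proof.
case: w => [|a t] /=; first by rewrite addr0.
by have [hD _ _] := magnus_map_hom a; case: t => [|b t]; rewrite hD linearD.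
Qed.

Lemma coordZ w c f : coord w (c *: f) = c * coord w f.
Proof.
case: w => [|a t] /=; first by rewrite mulr0.
by have [_ hZ _] := magnus_map_hom a; case: t => [|b t]; rewrite hZ linearZ.
Qed.

Lemma coord_derived1 a f : derived L 1 f -> coord [:: a] f = 0.
Proof. by move=> Df; rewrite /= magnus_map_derived1 ?linear0. Qed.

Lemma coord_word v w : inN v -> inN w -> coord w (wordL k v) = (v == w)%:R.
Proof.
case: v => [|x [|y s]] // Nv; case: w => [|a [|b t]] // Nw.
- have := l_prod [:: x] [:: a]; rewrite big_seq1 /= magnus_map_gen => ->.
  congr (_%:R); congr (nat_of_bool _).
  by apply/idP/eqP => [/perm_small_eq ->|->].
(* The second component of a letter is the constant 0 or 1, which has no coefficient at a nonempty
   monomial. *)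
- rewrite /= magnus_map_gen eqseq_cons andbF linearMn /=.
  have := l_prod [::] (b :: t); rewrite big_nil => ->.
  by case: (boolP (perm_eq _ _)) => [/perm_size //|_]; rewrite mul0rn.
- rewrite eqseq_cons andbF; apply: coord_derived1.
  exact/(@derived1_lmul _ _ _ _ s)/derived1_bracket.
rewrite -[LHS]/(l (b :: t) (magnus_map a _).2).
rewrite magnus_map_word linearB !linearMn /= !l_prod -!mulrnA !mulnb.
move: Nv Nw; rewrite /inN /= => /andP[yx sy] /andP[ba sb].
suff [-> ->] : perm_eq (y :: s) (b :: t) && (x == a)
    = ([:: x, y & s] == [:: a, b & t])
  /\ perm_eq (x :: s) (b :: t) && (y == a) = false.
  exact: subr0.
split.
  rewrite andbC eqseq_cons; congr (_ && _); apply/idP/eqP => [st|-> //].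
  exact: (sorted_eq le_trans le_anti).
(* If [y = a] then [b < y]; but [b] occurs in [x :: s], all of whose letters are at least [y]. *)
apply/negP => /andP[st /eqP ya].
suff : (y <= b)%O by rewrite ya leNgt ba.
have : b \in x :: s by rewrite (perm_mem st) mem_head.
rewrite inE => /orP[/eqP ->|bs]; first exact: ltW.
by have /allP := order_path_min le_trans sy; apply.
Qed.

End Coordinates.

(** * Uniqueness of expansions and linearity of coefficients *)

Section Expansion.
Local Open Scope ring_scope.
Variables (k : fieldType) (d : Order.disp_t) (X : orderType d).
Local Notation L := (L2 k X).
Implicit Types (f g : L) (u v w : seq X) (a : X).

Lemma coord_exists : exists c : seq X -> L -> k,
  [/\ forall w f g, c w (f + g) = c w f + c w g,
      forall w x f, c w (x *: f) = x * c w f,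
      forall u w, inN u -> inN w -> c w (wordL k u) = (u == w)%:R
    & forall a f, derived L 1 f -> c [:: a] f = 0].
Proof.
have [P [e [l le_]]] := monomial_forms_exist k X.
exists (coord e l); split.
- exact: coordD.
- exact: coordZ.
- exact: coord_word.
- exact: coord_derived1.
Qed.

(** Spanning provides an expansion, so [xget] returns a genuine one instead of its default. *)
Lemma expansionP f : is_expansion f (expansion f).
Proof.
apply: (@xgetPex _ [fsfun]); have [n [c [v [Nv ->]]]] := span_words f.
have /choice[w wP] i : exists w, inN w /\ wordL k w = v i.
  by have [w Nw <-] := Nv i; exists w.
pose S := [fset w i | i : 'I_n]%fset.
(* A word may occur several times in the given combination, so the coefficients of equal words are
   collected. *)
exists [fsfun u in S => \sum_(i < n | w i == u) c i | 0 : k].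
have sub_S : (finsupp
    [fsfun u in S => (\sum_(i < n | w i == u) c i : k) | 0 : k] `<=` S)%fset.
  exact: finsupp_sub.
split.
  apply/allP => u /(fsubsetP sub_S)/imfsetP[i _ ->]; exact: (wP i).1.
rewrite (big_fset_incl _ sub_S) /=; last first.
  by move=> u _; rewrite mem_finsupp negbK => /eqP ->; rewrite scale0r.
rewrite (eq_big_seq
  (fun u => \sum_(i < n) (if w i == u then c i *: v i else 0))).
  rewrite exchange_big; apply: eq_bigr => i _ /=.
  rewrite (bigD1_seq (w i)) ?fset_uniq ?in_imfset //= eqxx big1 ?addr0 //.
  by move=> u; rewrite eq_sym => /negbTE ->.
move=> u Su; rewrite fsfunE Su scaler_suml -big_mkcond.
by apply: eq_bigr => i /eqP <-; rewrite (wP i).2.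
Qed.

Lemma supp_inN f w : w \in supp f -> inN w.
Proof. by have [/allP + _] := expansionP f => /[apply]. Qed.

Lemma mem_supp f w : (w \in supp f) = (coef f w != 0).
Proof. exact: mem_finsupp. Qed.

Lemma coef_notN f w : ~~ inN w -> coef f w = 0.
Proof.
move=> Nw; apply/eqP/(contraNT _ Nw); rewrite -mem_supp; exact: supp_inN.
Qed.

Lemma expansionE f : f = \sum_(w <- supp f) coef f w *: wordL k w.
Proof. exact: (expansionP f).2. Qed.

(** A dual functional applied to the expansion isolates one coefficient. Thus [coef], defined
    through an arbitrary choice, agrees with a linear map. *)
Lemma coefE (c : seq X -> L -> k) :
  (forall w f g, c w (f + g) = c w f + c w g) ->
  (forall w x f, c w (x *: f) = x * c w f) ->
  (forall u w, inN u -> inN w -> c w (wordL k u) = (u == w)%:R) ->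
  forall f w, inN w -> coef f w = c w f.
Proof.
move=> cD cZ cW f w Nw; rewrite [in RHS](expansionE f).
have c0 : c w 0 = 0 by rewrite -(scale0r (0 : L)) cZ mul0r.
rewrite (big_morph (c w) (cD w) c0).
rewrite (eq_big_seq (fun u => if u == w then coef f w else 0)); last first.
  move=> u /supp_inN Nu; rewrite cZ cW //.
  by case: eqP => [->|_]; rewrite ?mulr1 ?mulr0.
have [wf|] := boolP (w \in supp f).
  rewrite (bigD1_seq w) ?fset_uniq //= eqxx big1 ?addr0 // => u.
  by move=> /negbTE ->.
move=> wf; rewrite big1_seq => [|u /andP[_ uf]].
  by move: wf; rewrite mem_supp negbK => /eqP.
by case: eqP => // uw; rewrite -uw uf in wf.
Qed.

Lemma coefD f g w : coef (f + g) w = coef f w + coef g w.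
Proof.
have [Nw|Nw] := boolP (inN w); last by rewrite !coef_notN ?addr0.
by have [c [cD cZ cW _]] := coord_exists; rewrite !(coefE cD cZ cW).
Qed.

Lemma coefZ x f w : coef (x *: f) w = x * coef f w.
Proof.
have [Nw|Nw] := boolP (inN w); last by rewrite !coef_notN ?mulr0.
by have [c [cD cZ cW _]] := coord_exists; rewrite !(coefE cD cZ cW).
Qed.

Lemma coef0 w : coef (0 : L) w = 0.
Proof. by rewrite -(scale0r (0 : L)) coefZ mul0r. Qed.

Lemma coef_word u w : inN u -> coef (wordL k u) w = (u == w)%:R.
Proof.
move=> Nu; have [Nw|Nw] := boolP (inN w); last first.
  by rewrite coef_notN //; case: eqP => // uw; rewrite -uw Nu in Nw.
by have [c [cD cZ cW _]] := coord_exists; rewrite (coefE cD cZ cW) // cW.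
Qed.

Lemma coef_derived1 a f : derived L 1 f -> coef f [:: a] = 0.
Proof.
have [c [cD cZ cW c1]] := coord_exists.
by move=> Df; rewrite (coefE cD cZ cW) // c1.
Qed.

Lemma lead_supp0 f : (forall w, coef f w = 0) -> lead f = [::].
Proof.
move=> f0; rewrite /lead big1_seq // => w /andP[_].
by rewrite mem_supp f0 eqxx.
Qed.

(** All coefficients at single letters vanish, so the linear part is zero and its leading word is
    the default [[::]]. *)
Lemma lead_part0_derived1 f : derived L 1 f -> lead (part0 f) = [::].
Proof.
move=> Df; suff -> : part0 f = 0 by apply: lead_supp0 => w; apply: coef0.
apply: big1 => -[|a [|b t]] // _.
by rewrite coef_derived1 // scale0r.
Qed.

End Expansion.

(** * Transport along an order embedding of the letters *)

Section Embedding.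
Local Open Scope ring_scope.
Variables (k : fieldType) (d d' : Order.disp_t) (X : orderType d).
Variables (Y : orderType d') (i : X -> Y).
Hypothesis i_mono : forall x y, (i x <= i y)%O = (x <= y)%O.
Local Notation h := (@l2map k X Y i).
Implicit Types (f g : L2 k X) (s t u v w : seq X) (a x y : X).

Let i_lt x y : (i x < i y)%O = (x < y)%O.
Proof. exact: leW_mono. Qed.

Let i_inj : injective i.
Proof. exact: inc_inj. Qed.

Lemma sorted_map_mono t : sorted <=%O (map i t) = sorted <=%O t.
Proof. by rewrite sorted_map; apply: eq_sorted => x y; apply: i_mono. Qed.

Lemma inR_map w : inR (map i w) = inR w.
Proof.
by case: w => [|a [|b t]] //; rewrite /inR -(sorted_map_mono (b :: t)) -i_lt.
Qed.

Lemma inN_map w : inN (map i w) = inN w.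
Proof. by rewrite /inN size_map inR_map. Qed.

Lemma osort_map t : osort (map i t) = map i (osort t).
Proof.
rewrite /osort sort_map; congr (map _ (sort _ _)).
by apply/funext => x; apply/funext => y; apply: i_mono.
Qed.

Lemma deglex_lt_map u v : deglex_lt (map i u) (map i v) = deglex_lt u v.
Proof.
rewrite /deglex_lt !size_map; congr (_ || _ && _).
elim: u v => [|x u IHu] [|y v] //.
by rewrite !map_cons !ltxi_cons !i_mono IHu.
Qed.

Lemma deglex_max_map u v :
  map i (deglex_max u v) = deglex_max (map i u) (map i v).
Proof. by rewrite /deglex_max deglex_lt_map; case: ifP. Qed.

Lemma l2map_lmul f t : h (lmul f t) = lmul (h f) (map i t).
Proof.
have [_ _ hM] := l2map_hom k i.
by elim: t f => // a t IHt f; rewrite lmul_cons IHt hM l2map_gen.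
Qed.

Lemma l2map_word w : h (wordL k w) = wordL k (map i w).
Proof.
case: w => [|a t]; first exact: lie_hom0 (l2map_hom k i).
by rewrite [LHS]l2map_lmul l2map_gen.
Qed.

(** Regular words go to regular words, so the image of an expansion is again a combination of basis
    words. *)
Lemma coef_l2map f (v : seq Y) :
  coef (h f) v = \sum_(w <- supp f) coef f w * (map i w == v)%:R.
Proof.
have [hD hZ _] := l2map_hom k i; rewrite [in LHS](expansionE f).
rewrite (big_morph h hD (lie_hom0 (l2map_hom k i))).
rewrite (big_morph (fun p => coef p v) (fun p q => coefD p q v) (coef0 k v)).
apply: eq_big_seq => w /supp_inN Nw.
by rewrite hZ coefZ l2map_word coef_word ?inN_map.
Qed.

Lemma coef_l2map_map f w : coef (h f) (map i w) = coef f w.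
Proof.
rewrite coef_l2map; have [wf|wf] := boolP (w \in supp f).
  rewrite (bigD1_seq w) ?fset_uniq //= eqxx mulr1 big1 ?addr0 // => u.
  by rewrite (inj_eq (inj_map i_inj)) => /negbTE ->; rewrite mulr0.
rewrite big1_seq => [|u /andP[_ uf]].
  by move: wf; rewrite mem_supp negbK => /eqP.
rewrite (inj_eq (inj_map i_inj)); case: eqP => [uw|_]; last exact: mulr0.
by rewrite -uw uf in wf.
Qed.

Lemma supp_l2map f : perm_eq (supp (h f)) (map (map i) (supp f)).
Proof.
apply: uniq_perm; rewrite ?fset_uniq // ?map_inj_uniq ?fset_uniq //.
  exact: inj_map.
move=> v; apply/idP/mapP => [|[w wf ->]]; last first.
  by rewrite mem_supp coef_l2map_map -mem_supp.
rewrite mem_supp; apply: contraNP => nv; rewrite coef_l2map big1_seq // => w.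
move=> /andP[_ wf]; case: eqP => [wv|_]; last exact: mulr0.
by case: nv; exists w.
Qed.

(** [map i] is a morphism for [deglex_max], and commutativity of the latter makes the enumeration of
    the support irrelevant. *)
Lemma lead_l2map f : lead (h f) = map i (lead f).
Proof.
rewrite /lead (perm_big _ (supp_l2map f)) big_map.
by rewrite (big_morph (map i) deglex_max_map (erefl (map i [::]))).
Qed.

(** Injectivity, by reading off coefficients; it keeps monic polynomials and the normal words of
    [trivial_mod] nonzero. *)
Lemma l2map_eq0 f : h f = 0 -> f = 0.
Proof.
move=> hf0; rewrite (expansionE f) big1 // => w _.
by rewrite -coef_l2map_map hf0 coef0 scale0r.
Qed.

Lemma monicL_l2map f : monicL f -> monicL (h f).
Proof.
case=> f0 f1; split; first by apply: contra_neq f0; apply: l2map_eq0.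
by rewrite /lcoef lead_l2map coef_l2map_map.
Qed.

Lemma normal_word_l2map S T g : h @` S `<=` T ->
  normal_word S g -> normal_word T (h g).
Proof.
move=> ST; have hT f : S f -> T (h f) by move=> Sf; apply: ST; exists f.
case=> [s t Ss st lt|u s Ss Ru lu].
  rewrite l2map_lmul; apply: NormalLetters; rewrite ?sorted_map_mono //.
    exact: hT.
  case: t lt {st} => //= a _; rewrite lead_l2map -[[:: i a]]/(map i [:: a]).
  by rewrite (inj_eq (inj_map i_inj)).
have [_ _ hM] := l2map_hom k i.
rewrite hM l2map_word; apply: NormalWord; rewrite ?inR_map //; first exact: hT.
by apply: contra_neq lu; rewrite lead_l2map => /(inj_map i_inj).
Qed.

Lemma trivial_mod_l2map S T w g : h @` S `<=` T ->
  trivial_mod S w g -> trivial_mod T (map i w) (h g).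
Proof.
move=> ST [n [c [v [Nv ->]]]]; have [hD hZ _] := l2map_hom k i.
exists n, c, (h \o v); split=> [j|] /=; last first.
  rewrite (big_morph h hD (lie_hom0 (l2map_hom k i))).
  by apply: eq_bigr => j _; rewrite hZ.
have [Nvj v0 vw] := Nv j; split.
- exact: normal_word_l2map Nvj.
- by apply: contra_neq v0; apply: l2map_eq0.
- by rewrite lead_l2map deglex_lt_map.
Qed.

(** The preimage of an ideal under a homomorphism is an ideal. *)
Lemma Id_l2map S T : h @` S `<=` Id T -> h @` Id S `<=` Id T.
Proof.
move=> ST _ [f Sf <-]; have [hD hZ hM] := l2map_hom k i.
have idT := smallest_ideal T.
apply: (Sf [set f | Id T (h f)]); split.
  split=> [|u v|c u|u v] /=; rewrite ?(lie_hom0 (l2map_hom k i)) ?hD ?hZ ?hM.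
  - exact: ideal0.
  - exact: idealD.
  - exact: idealZ.
  - exact: idealM.
by move=> g Sg /=; apply: ST; exists g.
Qed.

Let count_mem_notin (s : seq X) (z : Y) : (forall x, z <> i x) ->
  count_mem z (map i s) = 0%N.
Proof. by move=> nz; apply/count_memPn/mapP => -[x _ /nz]. Qed.

(** Least common multiples and quotients of monomials are given by multiplicities, so the comparison
    runs letter by letter; letters outside the image of [i] need a clause of their own. *)
Let perm_map_ms (M : {mset Y}%mset) (m : {mset X}%mset) :
  (forall x, M (i x) = m x) -> (forall z, (forall x, z <> i x) -> M z = 0%N) ->
  perm_eq M (map i m).
Proof.
move=> Mm M0; apply/allP => z _ /=; rewrite count_mem_mset.
have [[x ->]|nz] := pselect (exists x, z = i x).
  rewrite Mm count_map -count_mem_mset; apply/eqP/eq_count => y /=.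
  by rewrite (inj_eq i_inj).
have {}nz x : z <> i x by move=> zx; apply: nz; exists x.
by rewrite M0 // count_mem_notin.
Qed.

Let osort_ms (M : {mset Y}%mset) (m : {mset X}%mset) :
  (forall x, M (i x) = m x) -> (forall z, (forall x, z <> i x) -> M z = 0%N) ->
  osort M = map i (osort m).
Proof.
move=> Mm M0; rewrite -osort_map; apply/perm_sortP; last exact: perm_map_ms.
- exact: le_total.
- exact: le_trans.
- exact: le_anti.
Qed.

Let count_map_i x s : count_mem (i x) (map i s) = count_mem x s.
Proof.
by rewrite count_map; apply: eq_count => y /=; rewrite (inj_eq i_inj).
Qed.

Lemma osort_lcm_map u v :
  osort (msetU (seq_mset (map i u)) (seq_mset (map i v)))
  = map i (osort (msetU (seq_mset u) (seq_mset v))).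
Proof.
apply: osort_ms => [x|z nz]; rewrite !msetE2 !mset_seqE ?count_map_i //.
by rewrite !count_mem_notin.
Qed.

Lemma osort_lcm_quotient_map u v w :
  osort (msetB (msetU (seq_mset (map i u)) (seq_mset (map i v)))
               (seq_mset (map i w)))
  = map i (osort (msetB (msetU (seq_mset u) (seq_mset v)) (seq_mset w))).
Proof.
apply: osort_ms => [x|z nz]; rewrite !msetE2 !mset_seqE ?count_map_i //.
by rewrite !count_mem_notin.
Qed.

End Embedding.

(** * Ideals and compositions inside the derived algebra *)

Section Derived1.
Local Open Scope ring_scope.
Variables (k : fieldType) (d : Order.disp_t) (X : orderType d).
Implicit Types (f g : L2 k X).

Lemma sub_Id (S : set (L2 k X)) : S `<=` Id S.
Proof. by move=> f Sf I [_ SI]; apply: SI. Qed.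

Lemma Id_sub (S I : set (L2 k X)) : is_ideal I -> S `<=` I -> Id S `<=` I.
Proof. by move=> idI SI f; apply. Qed.

(** [T] lies in [Id T], which equals [Id S], and the derived algebra is an ideal containing [S]. *)
Lemma gs_basis_for_derived1 (S T : set (L2 k X)) :
  S `<=` derived (L2 k X) 1 -> gs_basis_for S T -> T `<=` derived (L2 k X) 1.
Proof.
move=> SD [_ IdT] f /sub_Id; rewrite IdT.
exact: Id_sub (derived_ideal _ 1) SD _.
Qed.

(** Types II to VII all prescribe a single letter as the leading word of [part0 g], which is empty
    here. *)
Lemma composition_derived1 f g w p :
  derived (L2 k X) 1 f -> derived (L2 k X) 1 g -> composition f g w p ->
  exists a u v, let m := msetU (seq_mset u) (seq_mset v) in
    [/\ lead f = a :: u, lead g = a :: v, w = a :: osort m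
      & p = lmul f (osort (msetB m (seq_mset u)))
          - lmul g (osort (msetB m (seq_mset v)))].
Proof.
move=> _ Dg C; have g0 := lead_part0_derived1 Dg; case: w p / C.
- by move=> a u v m fa ga ->; exists a, u, v.
- by move=> a u b v _ _; rewrite g0.
- by move=> a b v _ _ gb; rewrite g0 gb.
- by move=> a b v c _ _ _; rewrite g0.
- by move=> a u b _ _ _ _; rewrite g0.
- by move=> a b c _; rewrite g0.
- by move=> a b c _ _ _; rewrite g0.
Qed.

End Derived1.

(** * Lifting compositions, and the free product *)

(** A type I composition is built from leading words, sorted multisets and products by letters, all
    of which commute with the embedding. Injectivity of [i] brings the common first letter back to
    [X]. *)
Lemma composition_l2map (k : fieldType) (d d' : Order.disp_t) (X : orderType d)
    (Y : orderType d') (i : X -> Y) (f g : L2 k X) (w : seq Y) (p : L2 k Y) :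
  (forall x y, (i x <= i y)%O = (x <= y)%O) ->
  derived (L2 k X) 1 f -> derived (L2 k X) 1 g ->
  composition (l2map i f) (l2map i g) w p ->
  exists v q, [/\ composition f g v q, w = map i v & p = l2map i q].
Proof.
move=> i_mono Df Dg /composition_derived1 [].
- exact: lie_hom_derived (l2map_hom k i) 1 f Df.
- exact: lie_hom_derived (l2map_hom k i) 1 g Dg.
move=> a' [u' [v' [+ + -> ->]]]; rewrite !lead_l2map //.
case Ef : (lead f) => [|a u] // [<- <-].
case Eg : (lead g) => [|b v] //= [ba <-].
have {ba} ba : b = a by apply: (inc_inj i_mono).
rewrite ba in Eg; rewrite osort_lcm_map // !osort_lcm_quotient_map //.
eexists; eexists; split; first exact: CompI Ef Eg (erefl _).
  by [].
have [hD hZ _] := l2map_hom k i.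
by rewrite hD -(scaleN1r (lmul g _)) hZ scaleN1r !l2map_lmul.
Qed.

(* X is the union of its disjoint subsets X1 and X2, given by the embeddings
   i1 and i2. *)
Theorem proposition3p2 (k : fieldType) (d1 d2 d : Order.disp_t)
    (X1 : orderType d1) (X2 : orderType d2) (X : orderType d)
    (wfX1 : well_founded (fun x y : X1 => (x < y)%O))
    (wfX2 : well_founded (fun x y : X2 => (x < y)%O))
    (wfX : well_founded (fun x y : X => (x < y)%O))
    (i1 : X1 -> X) (i2 : X2 -> X)
    (i1_mono : forall x y : X1, (i1 x <= i1 y)%O = (x <= y)%O)
    (i2_mono : forall x y : X2, (i2 x <= i2 y)%O = (x <= y)%O)
    (i12_disjoint : forall (x : X1) (y : X2), i1 x <> i2 y)
    (i12_cover : forall z : X,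
       (exists x : X1, z = i1 x) \/ (exists y : X2, z = i2 y))
    (S1 SC1 : set (L2 k X1)) (S2 SC2 : set (L2 k X2))
    (S1_derived : S1 `<=` derived (L2 k X1) 1)
    (S2_derived : S2 `<=` derived (L2 k X2) 1)
    (S1_monic : forall f, S1 f -> monicL f)
    (S2_monic : forall f, S2 f -> monicL f)
    (S1_complement : gs_complement S1 SC1)
    (S2_complement : gs_complement S2 SC2) :
  gs_basis_for (l2map i1 @` S1 `|` l2map i2 @` S2)
               (l2map i1 @` SC1 `|` l2map i2 @` SC2).

Proof.
have [[[SC1_monic SC1_comp] Id1] _] := S1_complement.
have [[[SC2_monic SC2_comp] Id2] _] := S2_complement.
have D1 := gs_basis_for_derived1 S1_derived (proj1 S1_complement).
have D2 := gs_basis_for_derived1 S2_derived (proj1 S2_complement).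
set T := l2map i1 @` SC1 `|` l2map i2 @` SC2.
have T1 : l2map i1 @` SC1 `<=` T by move=> f; left.
have T2 : l2map i2 @` SC2 `<=` T by move=> f; right.
split; first split.
- by move=> _ [[f Sf <-]|[f Sf <-]]; apply: monicL_l2map => //;
    [apply: SC1_monic|apply: SC2_monic].
(* Leading words from the two sides start with letters of disjoint alphabets, whereas type I needs a
   common first letter. *)
- have mixed f g w p : SC1 f -> SC2 g ->
      composition (l2map i1 f) (l2map i2 g) w p \/
      composition (l2map i2 g) (l2map i1 f) w p -> False.
    move=> /D1/(lie_hom_derived (l2map_hom k i1)) Df.
    move=> /D2/(lie_hom_derived (l2map_hom k i2)) Dg.
    case=> /composition_derived1[]// a [u [v []]]; rewrite !lead_l2map //.
      case: (lead f) => // x ? [<- _].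
      by case: (lead g) => // y ? [/esym/i12_disjoint].
    case: (lead g) => // y ? [<- _].
    by case: (lead f) => // x ? [/i12_disjoint].
  move=> _ _ w p [[f Sf <-]|[f Sf <-]] [[g Sg <-]|[g Sg <-]] C.
  + have [v [q [Cq -> ->]]] := composition_l2map i1_mono (D1 _ Sf) (D1 _ Sg) C.
    exact: trivial_mod_l2map T1 (SC1_comp _ _ _ _ Sf Sg Cq).
  + by case: (mixed f g w p) => //; left.
  + by case: (mixed g f w p) => //; right.
  + have [v [q [Cq -> ->]]] := composition_l2map i2_mono (D2 _ Sf) (D2 _ Sg) C.
    exact: trivial_mod_l2map T2 (SC2_comp _ _ _ _ Sf Sg Cq).
(* Stated for arbitrary generating sets so that exchanging their roles yields both inclusions. *)
have IdU (A1 B1 : set (L2 k X1)) (A2 B2 : set (L2 k X2)) :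
    Id A1 = Id B1 -> Id A2 = Id B2 ->
    Id (l2map i1 @` A1 `|` l2map i2 @` A2)
    `<=` Id (l2map i1 @` B1 `|` l2map i2 @` B2).
  move=> E1 E2; apply: Id_sub; first exact: smallest_ideal.
  move=> _ [[f Af <-]|[f Af <-]].
    apply: (Id_l2map (S := B1)) => [p Bp|].
      by apply: sub_Id; left; exact: Bp.
    by exists f => //; rewrite -E1; apply: sub_Id.
  apply: (Id_l2map (S := B2)) => [p Bp|].
    by apply: sub_Id; right; exact: Bp.
  by exists f => //; rewrite -E2; apply: sub_Id.
by apply/seteqP; split; apply: IdU.
Qed.
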